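(* Let $w_1,w_2,w_3,e_1,e_2,e_3$ be positive real numbers such that $w_1 \geqslant w_2 \geqslant w_3$ and $e_1 \geqslant e_2 \geqslant e_3$. Then $T_{w_1,w_2,w_3}$ has a fractional $T_{e_1,e_2,e_3}$-decomposition if and only if \[\frac{w_3}{w_1+w_2+w_3} \geqslant \frac{e_3}{e_1+e_2+e_3}\quad\text{and}\quad\frac{w_1}{w_1+w_2+w_3} \leqslant \frac{e_1}{e_1+e_2+e_3}.\]
   Context: For positive reals $a,b,c$, $T_{a,b,c}$ denotes the weighted triangle: the graph $K_3$ with its three edges given weights $a,b,c$. A scaled copy of a weighted graph $W$ is a weighted graph $W'$ with an isomorphism $f$ of underlying graphs and a positive real $\alpha$ such that $w_{W'}(e)=\alpha w_W(f(e))$ for all edges. A fractional $W$-decomposition of a weighted graph $Q$ is a finite collection of weighted graphs, each a scaled copy of $W$ whose underlying graph is a subgraph of the underlying graph of $Q$, such that for every edge $e$ of $Q$ the sum of the weights the collection assigns to $e$ equals $w_Q(e)$. *)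

(* Defs.v *)
From mathcomp Require Import all_boot all_order all_algebra.
From mathcomp Require Import reals.
Set Implicit Arguments.
Unset Strict Implicit.
Unset Printing Implicit Defensive.
Import Order.TTheory GRing.Theory Num.Theory.
Local Open Scope ring_scope.

(* A finite simple graph whose vertices are taken from the ambient type V, with
   edges as two-element vertex sets. The values of [weight] outside [edges] are
   never used. No sign is imposed on the weights: [triangle] is only used with
   positive weights, and a scaled copy has positive weights if the original
   does. *)
Record wgraph (R : realType) (V : finType) := WGraph {
  verts : {set V};
  edges : {set {set V}};
  weight : {set V} -> R;
  edgesP : forall e : {set V}, e \in edges -> (e \subset verts) && (#|e| == 2%N)
}.

Definition subgraph (R : realType) (V : finType) (H Q : wgraph R V) : Prop :=
  (verts H \subset verts Q) /\ (edges H \subset edges Q).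

Definition graph_iso (R : realType) (V U : finType)
    (H : wgraph R V) (W : wgraph R U) (f : V -> U) : Prop :=
  [/\ {in verts H &, injective f},
      f @: verts H = verts W &
      {in verts H &, forall x y,
        ([set x; y] \in edges H) = ([set f x; f y] \in edges W)}].

Definition scaled_copy (R : realType) (V U : finType)
    (H : wgraph R V) (W : wgraph R U) : Prop :=
  exists (f : V -> U) (alpha : R),
    [/\ graph_iso H W f, 0 < alpha &
        forall e, e \in edges H -> weight H e = alpha * weight W (f @: e)].

(* The collection is a finite indexed family, so repetitions are allowed. *)
Definition fractional_decomposition (R : realType) (V U : finType)
    (W : wgraph R U) (Q : wgraph R V) (n : nat) (D : 'I_n -> wgraph R V) : Prop :=
  (forall i, scaled_copy (D i) W /\ subgraph (D i) Q) /\
  (forall e, e \in edges Q ->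
     \sum_(i < n | e \in edges (D i)) weight (D i) e = weight Q e).

Definition has_fractional_decomposition (R : realType) (V U : finType)
    (W : wgraph R U) (Q : wgraph R V) : Prop :=
  exists (n : nat) (D : 'I_n -> wgraph R V), fractional_decomposition W Q D.

Definition K3_edges : {set {set 'I_3}} := [set e : {set 'I_3} | #|e| == 2%N].

Lemma K3_edgesP (e : {set 'I_3}) :
  e \in K3_edges -> (e \subset [set: 'I_3]) && (#|e| == 2%N).
Proof. by rewrite inE subsetT. Qed.

(* Edges {0,1}, {0,2}, {1,2} get weights a, b, c. *)
Definition triangle (R : realType) (a b c : R) : wgraph R 'I_3 :=
  WGraph
    (fun e : {set 'I_3} =>
       if e == [set inord 0; inord 1] then a
       else if e == [set inord 0; inord 2] then b
       else c)
    K3_edgesP.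

(* Main.v *)
Require Import Defs.
From mathcomp Require Import all_boot all_order all_algebra.
From mathcomp Require Import all_fingroup.
From mathcomp Require Import reals.
From mathcomp Require Import ring lra.
Import Order.TTheory GRing.Theory Num.Theory.
Local Open Scope ring_scope.

Set Implicit Arguments.
Unset Strict Implicit.
Unset Printing Implicit Defensive.

(** An edge of [K_3] is determined by the vertex opposite to it, so a weighted
    triangle is a function on the vertices, and [T_w] is decomposable into scaled
    copies of [T_e] iff [w] is a nonnegative combination of the permutations of
    [e].  Such a combination with total coefficient [A] has sum
    [A * (e1 + e2 + e3)] and all its entries lie in [[A * e3, A * e1]], which gives
    necessity.  Conversely, after rescaling [e] to the same sum as [w], the two
    inequalities say that [w] is majorized by [e], and [w] is reached from [e] by
    two transfers between pairs of coordinates: if [w1 >= e2], first fix the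
    largest coordinate, otherwise first fix the smallest. *)

Definition perm_cone (R : realType) (T : finType) (g h : T -> R) : Prop :=
  exists2 c : {perm T} -> R, forall s, 0 <= c s &
    forall v, h v = \sum_(s : {perm T}) c s * g (s v).

Lemma perm_cone_scale (R : realType) (T : finType) (g : T -> R) (k : R) :
  0 <= k -> perm_cone g (fun v => k * g v).
Proof.
move=> k0; exists (fun s => if s == 1%g then k else 0) => [s|v].
  by case: ifP.
rewrite (bigD1 1%g) //= eqxx perm1 big1 ?addr0 // => s /negPf ->.
by rewrite mul0r.
Qed.

Lemma convex_weight (R : realType) (a b x : R) : b <= x <= a ->
  exists2 t : R, 0 <= t <= 1 & x = t * a + (1 - t) * b.
Proof.
move=> /andP[bx xa]; have [ab|ab] := eqVneq a b.
  by exists 1; [rewrite ler01 lexx | lra].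
have ab0 : 0 < a - b by rewrite subr_gt0 lt_neqAle eq_sym ab (le_trans bx).
exists ((x - b) / (a - b)); last by field; rewrite gt_eqF.
by rewrite divr_ge0 ?ler_pdivrMr //=; lra.
Qed.

(** The function [h'] is a convex combination of [h] and of [h] with [x] and [y] swapped; the cone
    is convex and stable under permuting coordinates. *)
Lemma perm_cone_transfer (R : realType) (T : finType) (g h h' : T -> R) (x y : T) :
  x != y -> perm_cone g h -> h y <= h' x <= h x -> h' x + h' y = h x + h y ->
  (forall z, z != x -> z != y -> h' z = h z) -> perm_cone g h'.
Proof.
move=> xy [c c0 hE] /convex_weight[t /andP[t0 t1] tE] sumE h'E.
(* Composing [h] with [tperm x y] shifts its coefficients to [c (tperm x y * s)]. *)
exists (fun s => t * c s + (1 - t) * c (tperm x y * s)%g) => [s|v].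
  by rewrite addr_ge0 // mulr_ge0 // subr_ge0.
have -> : \sum_(s : {perm T}) (t * c s + (1 - t) * c (tperm x y * s)%g) * g (s v)
        = t * h v + (1 - t) * h (tperm x y v).
  rewrite !hE !mulr_sumr [X in _ = _ + X](reindex_inj (mulgI (tperm x y))) /=.
  rewrite -big_split /=; apply: eq_bigr => s _.
  by rewrite permM tpermK mulrDl !mulrA.
have [->|vx] := eqVneq v x; first by rewrite tpermL.
have [->|vy] := eqVneq v y; first by rewrite tpermR; lra.
by rewrite tpermD 1?eq_sym // h'E //; lra.
Qed.

(** On ['I_3] this says that an injective vertex map respects the opposition between edges and
    vertices. *)
Lemma imsetC1_inj (T : finType) (f : T -> T) (v : T) :
  injective f -> f @: (~: [set v]) = ~: [set f v].
Proof.
move=> fI.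
apply/setP=> u; have [g fK gK] := injF_bij fI.
by rewrite -[u]gK mem_imset // !inE (inj_eq fI).
Qed.

Lemma K3_edgeP (e : {set 'I_3}) :
  reflect (exists v, e = ~: [set v]) (e \in K3_edges).
Proof.
rewrite inE; apply: (iffP eqP) => [e2|[v ->]]; last first.
  by rewrite cardsC1 card_ord.
have /eqP/cards1P[v ev] : #|~: e| = 1%N by rewrite cardsCs setCK card_ord e2.
by exists v; rewrite -ev setCK.
Qed.

Definition opp_weight (R : realType) (a b c : R) (v : 'I_3) : R :=
  weight (triangle a b c) (~: [set v]).

Lemma inord_eq (n i j : nat) : (i <= n)%N -> (j <= n)%N ->
  (inord i == inord j :> 'I_n.+1) = (i == j).
Proof. by move=> le_in le_jn; rewrite -val_eqE /= !inordK. Qed.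

Lemma opp_weightE (R : realType) (a b c : R) :
  [/\ opp_weight a b c (inord 2) = a, opp_weight a b c (inord 1) = b
    & opp_weight a b c (inord 0) = c].
Proof.
have E (x y v : 'I_3) : x != y ->
    (~: [set v] == [set x; y]) = (v != x) && (v != y).
  move=> xy; rewrite eq_sym eqEcard cards2 cardsC1 card_ord xy andbT.
  by rewrite subsetC sub1set !inE negb_or.
by rewrite /opp_weight /= !E ?inord_eq.
Qed.

Lemma ord3_cases (v : 'I_3) : [\/ v = inord 0, v = inord 1 | v = inord 2].
Proof.
case: v => [[|[|[|//]]]] lt_v; [constructor 1|constructor 2|constructor 3];
  by apply/val_inj; rewrite /= inordK.
Qed.

Lemma sum_ord3 (R : realType) (h : 'I_3 -> R) :
  \sum_v h v = h (inord 2) + h (inord 1) + h (inord 0).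
Proof.
rewrite 3!big_ord_recr big_ord0 /= add0r [RHS]addrC addrA [RHS]addrAC.
by congr (h _ + h _ + h _); apply/val_inj; rewrite /= inordK.
Qed.

(** The isomorphism forces a copy to have three vertices, hence to fill ['I_3] and carry all its
    edges. Scale factor and vertex map form one pair so that a single choice over the family yields
    both. *)
Lemma scaled_triangle_copy (R : realType) (a b c a' b' c' : R)
    (H : wgraph R 'I_3) :
  scaled_copy H (triangle a b c) -> subgraph H (triangle a' b' c') ->
  edges H = K3_edges /\
  exists k : R * ('I_3 -> 'I_3), [/\ 0 < k.1, injective k.2 &
    forall v, weight H (~: [set v]) = k.1 * opp_weight a b c (k.2 v)].
Proof.
move=> [f [k [[fI fV fE] k0 fW]]] [_ /= sHK].
have HT : verts H = setT.
  by apply/eqP; rewrite eqEcard subsetT -(card_in_imset fI) fV /=.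
have {}fI : injective f by move=> x y; apply: fI; rewrite HT inE.
have HK : edges H = K3_edges.
  apply/eqP; rewrite eqEsubset sHK; apply/subsetP => e.
  rewrite inE => /cards2P[x [y [xy ->]]].
  by rewrite fE ?HT ?inE //= cards2 (inj_eq fI) xy.
split=> //; exists (k, f); split=> // v.
rewrite fW ?HK; first by rewrite imsetC1_inj.
by apply/K3_edgeP; exists v.
Qed.

Lemma perm_cone_decomposition (R : realType) (a b c a' b' c' : R) :
  perm_cone (opp_weight a b c) (opp_weight a' b' c') ->
  has_fractional_decomposition (triangle a b c) (triangle a' b' c').
Proof.
(* A scaled copy needs a positive factor, so only permutations with nonzero coefficient contribute
   one. *)
move=> [k k0 kE]; pose P := [pred s : {perm 'I_3} | 0 < k s].
pose D (s : {perm 'I_3}) : wgraph R 'I_3 :=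
  WGraph (fun e => k s * weight (triangle a b c) (s @: e)) K3_edgesP.
exists #|P|, (fun i => D (enum_val i)); split=> [i|e].
  have := enum_valP i; rewrite inE; set s := enum_val i => ks.
  split; last by split.
  exists s, (k s); split=> //; split=> /=.
  - by move=> x y _ _; apply: perm_inj.
  - by apply/eqP; rewrite eqEcard subsetT (card_imset _ perm_inj) leqnn.
  - by move=> x y _ _; rewrite !inE !cards2 (inj_eq perm_inj).
move=> eK; rewrite (eq_bigl xpredT) /=; last by move=> i; exact: eK.
rewrite -(big_enum_val (A := P) (fun s => weight (D s) e)) /=.
have /K3_edgeP[v ->] := eK.
have := kE v; rewrite /opp_weight /= => ->.
rewrite [RHS](bigID P) /= [X in _ + X]big1 ?addr0.
  by apply: eq_bigr => s _; rewrite imsetC1_inj //; apply: perm_inj.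
move=> s /negPf ks; suff -> : k s = 0 by rewrite mul0r.
by apply/eqP; have := k0 s; rewrite le_eqVlt ks orbF eq_sym.
Qed.

Lemma perm_cone_majorized (R : realType) (w1 w2 w3 e1 e2 e3 k : R) :
  0 <= k -> w2 <= w1 -> w3 <= w2 -> k * e2 <= k * e1 -> k * e3 <= k * e2 ->
  w1 + w2 + w3 = k * e1 + k * e2 + k * e3 -> k * e3 <= w3 -> w1 <= k * e1 ->
  perm_cone (opp_weight e1 e2 e3) (opp_weight w1 w2 w3).
Proof.
move=> k0 w21 w32 e21 e32 sumE w3e w1e.
have [E2 E1 E0] := opp_weightE e1 e2 e3.
have [W2 W1 W0] := opp_weightE w1 w2 w3.
have C0 := perm_cone_scale (opp_weight e1 e2 e3) k0.
have [ew|we] := leP (k * e2) w1.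
  (* The middle entry keeps the total fixed. It equals [w2 + w3 - k * e3], which is at least [w2],
     so the second transfer can lower it to [w2]. *)
  have [U2 U1 U0] := opp_weightE w1 (k * e1 + k * e2 - w1) (k * e3).
  have C1 : perm_cone (opp_weight e1 e2 e3)
      (opp_weight w1 (k * e1 + k * e2 - w1) (k * e3)).
    apply: (@perm_cone_transfer _ _ _ _ _ (inord 2) (inord 1) _ C0).
    - by rewrite inord_eq.
    - by rewrite U2 E1 E2 ew.
    - by rewrite U2 U1 E1 E2; lra.
    - by move=> z; case: (ord3_cases z) => -> //; rewrite ?eqxx // U0 E0.
  apply: (@perm_cone_transfer _ _ _ _ _ (inord 1) (inord 0) _ C1).
  - by rewrite inord_eq.
  - by rewrite U1 U0 W1; lra.
  - by rewrite U1 U0 W1 W0; lra.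
  - by move=> z; case: (ord3_cases z) => -> //; rewrite ?eqxx // U2 W2.
(* Here [w3 <= w1 < k * e2] makes the first transfer legal. The middle entry equals
   [w1 + w2 - k * e1], at most [w1] since [w2 <= k * e1], so the second transfer can lower [k * e1]
   to [w1]. *)
have [U2 U1 U0] := opp_weightE (k * e1) (k * e2 + k * e3 - w3) w3.
have C1 : perm_cone (opp_weight e1 e2 e3)
    (opp_weight (k * e1) (k * e2 + k * e3 - w3) w3).
  apply: (@perm_cone_transfer _ _ _ _ _ (inord 1) (inord 0) _ C0).
  - by rewrite inord_eq.
  - by rewrite U1 E1 E0; lra.
  - by rewrite U1 U0 E1 E0; lra.
  - by move=> z; case: (ord3_cases z) => -> //; rewrite ?eqxx // U2 E2.
apply: (@perm_cone_transfer _ _ _ _ _ (inord 2) (inord 1) _ C1).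
- by rewrite inord_eq.
- by rewrite U2 U1 W2; lra.
- by rewrite U2 U1 W2 W1; lra.
- by move=> z; case: (ord3_cases z) => -> //; rewrite ?eqxx // U0 W0.
Qed.

Lemma decomposition_total_scale (R : realType) (w1 w2 w3 e1 e2 e3 : R) :
  e2 <= e1 -> e3 <= e2 ->
  has_fractional_decomposition (triangle e1 e2 e3) (triangle w1 w2 w3) ->
  exists A : R, [/\ w1 + w2 + w3 = A * (e1 + e2 + e3), A * e3 <= w3 & w1 <= A * e1].
Proof.
move=> e21 e32 [n [D [DP DE]]].
have [k kP] := fin_all_exists
  (fun i => (scaled_triangle_copy (DP i).1 (DP i).2).2).
have wE v : opp_weight w1 w2 w3 v =
    \sum_i (k i).1 * opp_weight e1 e2 e3 ((k i).2 v).
  have vK : ~: [set v] \in K3_edges by apply/K3_edgeP; exists v.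
  rewrite /opp_weight -DE //; apply: eq_big => [i|i _].
    by have [-> _] := scaled_triangle_copy (DP i).1 (DP i).2.
  by have [_ _ ->] := kP i.
have [E2 E1 E0] := opp_weightE e1 e2 e3.
have [W2 W1 W0] := opp_weightE w1 w2 w3.
have eB v : e3 <= opp_weight e1 e2 e3 v <= e1.
  by case: (ord3_cases v) => ->; rewrite ?E0 ?E1 ?E2; lra.
exists (\sum_i (k i).1); split.
- have -> : w1 + w2 + w3 = \sum_v opp_weight w1 w2 w3 v.
    by rewrite sum_ord3 W2 W1 W0.
  have -> : e1 + e2 + e3 = \sum_v opp_weight e1 e2 e3 v.
    by rewrite sum_ord3 E2 E1 E0.
  (* Summed over the vertices, each copy contributes its factor times [e1 + e2 + e3], since its
     vertex map is a bijection. *)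
  rewrite (eq_bigr _ (fun v _ => wE v)) exchange_big mulr_suml /=.
  apply: eq_bigr => i _; rewrite -mulr_sumr; congr (_ * _).
  by have [_ kI _] := kP i; rewrite [RHS](reindex_inj kI).
- rewrite -[leRHS]W0 wE mulr_suml ler_sum // => i _.
  by have [k0 _ _] := kP i; rewrite ler_pM2l //; case/andP: (eB ((k i).2 (inord 0))).
- rewrite -[leLHS]W2 wE mulr_suml ler_sum // => i _.
  by have [k0 _ _] := kP i; rewrite ler_pM2l //; case/andP: (eB ((k i).2 (inord 2))).
Qed.

Theorem theorem3p2 (R : realType) (w1 w2 w3 e1 e2 e3 : R)
  (hw1 : 0 < w1) (hw2 : 0 < w2) (hw3 : 0 < w3)
  (he1 : 0 < e1) (he2 : 0 < e2) (he3 : 0 < e3)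
  (hw12 : w1 >= w2) (hw23 : w2 >= w3)
  (he12 : e1 >= e2) (he23 : e2 >= e3) :
  has_fractional_decomposition (triangle e1 e2 e3) (triangle w1 w2 w3) <->
  (w3 / (w1 + w2 + w3) >= e3 / (e1 + e2 + e3)) /\
  (w1 / (w1 + w2 + w3) <= e1 / (e1 + e2 + e3)).
Proof.
have S0 : 0 < e1 + e2 + e3 by rewrite !addr_gt0.
have T0 : 0 < w1 + w2 + w3 by rewrite !addr_gt0.
(* With denominators cleared, both inequalities compare [w] with [e] rescaled to the total of
   [w]. *)
have scaleE x : (w1 + w2 + w3) / (e1 + e2 + e3) * x =
    x / (e1 + e2 + e3) * (w1 + w2 + w3) by rewrite mulrC mulrA mulrAC.
rewrite ler_pdivlMr // ler_pdivrMr // -!scaleE; split.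
  (* Equality of totals forces [A] to be that same rescaling factor. *)
  move=> /(decomposition_total_scale he12 he23) [A [-> ? ?]].
  by rewrite mulfK ?gt_eqF.
move=> [h3 h1]; apply: perm_cone_decomposition.
have k0 : 0 < (w1 + w2 + w3) / (e1 + e2 + e3) by rewrite divr_gt0.
apply: perm_cone_majorized (ltW k0) _ _ _ _ _ h3 h1; rewrite ?ler_pM2l //.
by rewrite -!mulrDr divfK ?gt_eqF.
Qed.
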